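(* Let $n$ be a positive integer. Any subvariety of $\mathbb{V}(\mathbf{F}_n(\mathbb{Z}))$ is of the form $\mathbb{V}(\mathbf{F}_{k_1}(\mathbb{Z}),\dots,\mathbf{F}_{k_m}(\mathbb{Z}))$ for some $m\in\mathbb{N}$ and some positive integers $k_1\mid n,\dots,k_m\mid n$.
   Context: An $\ell$-pregroup is an algebra $(A,\wedge,\vee,\cdot,1,{}^{\ell},{}^{r})$ such that $(A,\wedge,\vee)$ is a lattice, $(A,\cdot,1)$ is a monoid, multiplication is order-preserving in both arguments, and $a^{\ell}a\le 1\le aa^{\ell}$ and $aa^{r}\le 1\le a^{r}a$ for all $a\in A$. Write $x^{\ell^k}$, $x^{r^k}$ for the $k$-fold application of ${}^\ell$, ${}^r$. $\mathbf{F}(\mathbb{Z})$ is the $\ell$-pregroup of all order-preserving maps $f\colon\mathbb{Z}\to\mathbb{Z}$ such that $f^{-1}[\{x\}]$ is finite for every $x\in\mathbb{Z}$, with composition as multiplication, the identity map as $1$, the pointwise order, and $f^{\ell}(q)=\min\{p: q\le f(p)\}$, $f^{r}(q)=\max\{p: f(p)\le q\}$. $\mathbf{F}_n(\mathbb{Z})$ is the subalgebra of all $f$ with $f^{\ell^n}=f^{r^n}$; equivalently, all $f\in \mathbf{F}(\mathbb{Z})$ with $f(x+n)=f(x)+n$ for all $x\in\mathbb{Z}$. $\mathbb{V}(\mathbf{A}_1,\dots,\mathbf{A}_m)$ denotes the variety generated by $\mathbf{A}_1,\dots,\mathbf{A}_m$; for $m=0$ it is the trivial variety. *)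

(* Defs.v *)
From mathcomp Require Import all_boot all_order all_algebra.
From mathcomp Require Import zify.
From mathcomp Require Import mathcomp_extra boolp classical_sets functions cardinality.

Set Implicit Arguments.
Unset Strict Implicit.
Unset Printing Implicit Defensive.

Import Order.TTheory GRing.Theory Num.Theory.

Local Open Scope classical_set_scope.
Local Open Scope ring_scope.

(* The carrier is an arbitrary type: classes of algebras must be closed under
   all the usual constructions, so no eqType or choiceType structure (and hence
   none of the order structures of the library) is imposed on it. *)
Record lp_alg := LpAlg {
  lp_sort :> Type;
  lp_meet : lp_sort -> lp_sort -> lp_sort;
  lp_join : lp_sort -> lp_sort -> lp_sort;
  lp_mul : lp_sort -> lp_sort -> lp_sort;
  lp_one : lp_sort;
  lp_l : lp_sort -> lp_sort;
  lp_r : lp_sort -> lp_sort }.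

Arguments lp_one {_}.

Declare Scope lp_scope.
Delimit Scope lp_scope with LP.
Bind Scope lp_scope with lp_sort.

Definition lp_le (A : lp_alg) (x y : A) : Prop := lp_meet x y = x.

Local Notation "x ⊓ y" := (lp_meet x y) (at level 48, left associativity) : lp_scope.
Local Notation "x ⊔ y" := (lp_join x y) (at level 50, left associativity) : lp_scope.
Local Notation "x * y" := (lp_mul x y) : lp_scope.
Local Notation "1" := lp_one : lp_scope.
Local Notation "x <= y" := (lp_le x y) : lp_scope.

Record lp_axioms (A : lp_alg) : Prop := LpAxioms {
  lp_meetC : commutative (@lp_meet A);
  lp_joinC : commutative (@lp_join A);
  lp_meetA : associative (@lp_meet A);
  lp_joinA : associative (@lp_join A);
  lp_joinKI : forall x y : A, (x ⊓ (x ⊔ y) = x)%LP;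
  lp_meetKU : forall x y : A, (x ⊔ (x ⊓ y) = x)%LP;
  lp_mulA : associative (@lp_mul A);
  lp_mul1 : left_id lp_one (@lp_mul A);
  lp_mulr1 : right_id lp_one (@lp_mul A);
  lp_mul2l : forall c a b : A, (a <= b)%LP -> (c * a <= c * b)%LP;
  lp_mul2r : forall c a b : A, (a <= b)%LP -> (a * c <= b * c)%LP;
  lp_mulVl : forall a : A, (lp_l a * a <= 1)%LP;
  lp_mullV : forall a : A, (1 <= a * lp_l a)%LP;
  lp_mulrV : forall a : A, (a * lp_r a <= 1)%LP;
  lp_mulVr : forall a : A, (1 <= lp_r a * a)%LP }.

Record lpregroup := Lpregroup {
  lp_base :> lp_alg;
  lpP : lp_axioms lp_base }.

Inductive lp_term : Type :=
  | TVar of nat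
  | TMeet of lp_term & lp_term
  | TJoin of lp_term & lp_term
  | TMul of lp_term & lp_term
  | TOne
  | TL of lp_term
  | TR of lp_term.

Fixpoint lp_eval (A : lp_alg) (v : nat -> A) (t : lp_term) : A :=
  match t with
  | TVar i => v i
  | TMeet s t => lp_meet (lp_eval v s) (lp_eval v t)
  | TJoin s t => lp_join (lp_eval v s) (lp_eval v t)
  | TMul s t => lp_mul (lp_eval v s) (lp_eval v t)
  | TOne => lp_one
  | TL t => lp_l (lp_eval v t)
  | TR t => lp_r (lp_eval v t)
  end.

Definition lp_sat (A : lp_alg) (e : lp_term * lp_term) : Prop :=
  forall v : nat -> A, lp_eval v e.1 = lp_eval v e.2.

(* Classes of algebras are plain predicates: using [set lpregroup] would force
   the universe of [set] above that of the carriers, and then sets of subsets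
   could no longer serve as carriers.
   A variety is an equational class. The equations are taken relative to
   l-pregroups, which are themselves axiomatized by equations; countably many
   variables suffice since an equation is a finite expression. *)
Definition is_variety (V : lpregroup -> Prop) : Prop :=
  exists E : lp_term * lp_term -> Prop,
    forall A : lpregroup, V A <-> (forall e, E e -> lp_sat A e).

Definition variety_gen (I : Type) (K : I -> lpregroup) (A : lpregroup) : Prop :=
  forall V : lpregroup -> Prop, is_variety V -> (forall i, V (K i)) -> V A.

Section Theory.
Variable A : lpregroup.
Implicit Types a b c x y : A.
Local Open Scope lp_scope.

Lemma lp_meetxx x : x ⊓ x = x.
Proof. by rewrite -{2}(lp_meetKU (lpP A) x x) (lp_joinKI (lpP A)). Qed.

Lemma lp_lexx x : x <= x. Proof. exact: lp_meetxx. Qed.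

Lemma lp_le_trans y x z : x <= y -> y <= z -> x <= z.
Proof. by rewrite /lp_le => xy yz; rewrite -xy -(lp_meetA (lpP A)) yz. Qed.

Lemma lp_le_anti x y : x <= y -> y <= x -> x = y.
Proof. by rewrite /lp_le => xy yx; rewrite -[LHS]xy (lp_meetC (lpP A)). Qed.

Lemma lp_leIl x y : x ⊓ y <= x.
Proof. by rewrite /lp_le (lp_meetC (lpP A)) (lp_meetA (lpP A)) lp_meetxx. Qed.

Lemma lp_leIr x y : x ⊓ y <= y.
Proof. by rewrite /lp_le -(lp_meetA (lpP A)) lp_meetxx. Qed.

Lemma lp_lexI z x y : z <= x -> z <= y -> z <= x ⊓ y.
Proof. by rewrite /lp_le (lp_meetA (lpP A)) => -> ->. Qed.

Lemma lp_leEjoin x y : x <= y <-> x ⊔ y = y.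
Proof.
rewrite /lp_le; split=> [<-|<-]; last exact: (lp_joinKI (lpP A) _ _).
by rewrite (lp_joinC (lpP A)) (lp_meetC (lpP A)) (lp_meetKU (lpP A)).
Qed.

Lemma lp_leUl x y : x <= x ⊔ y.
Proof. exact: (lp_joinKI (lpP A) _ _). Qed.

Lemma lp_leUr x y : y <= x ⊔ y.
Proof. by rewrite (lp_joinC (lpP A)); apply: lp_leUl. Qed.

Lemma lp_leUx z x y : x <= z -> y <= z -> x ⊔ y <= z.
Proof.
move=> /lp_leEjoin xz /lp_leEjoin yz; apply/lp_leEjoin.
by rewrite -(lp_joinA (lpP A)) yz xz.
Qed.

Lemma lp_l_unique a x : x * a <= 1 -> 1 <= a * x -> x = lp_l a.
Proof.
move=> xa ax; apply: lp_le_anti.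
- have := lp_mul2l (lpP A) x (lp_mullV (lpP A) a).
  rewrite (lp_mulr1 (lpP A)) (lp_mulA (lpP A)) => /lp_le_trans; apply.
  by have := lp_mul2r (lpP A) (lp_l a) xa; rewrite (lp_mul1 (lpP A)).
- have := lp_mul2l (lpP A) (lp_l a) ax.
  rewrite (lp_mulr1 (lpP A)) (lp_mulA (lpP A)) => /lp_le_trans; apply.
  by have := lp_mul2r (lpP A) x (lp_mulVl (lpP A) a); rewrite (lp_mul1 (lpP A)).
Qed.

Lemma lp_r_unique a x : a * x <= 1 -> 1 <= x * a -> x = lp_r a.
Proof.
move=> ax xa; apply: lp_le_anti.
- have := lp_mul2r (lpP A) x (lp_mulVr (lpP A) a).
  rewrite (lp_mul1 (lpP A)) -(lp_mulA (lpP A)) => /lp_le_trans; apply.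
  by have := lp_mul2l (lpP A) (lp_r a) ax; rewrite (lp_mulr1 (lpP A)).
- have := lp_mul2r (lpP A) (lp_r a) xa.
  rewrite (lp_mul1 (lpP A)) -(lp_mulA (lpP A)) => /lp_le_trans; apply.
  have := lp_mul2l (lpP A) x (lp_mulrV (lpP A) a).
  by rewrite (lp_mulr1 (lpP A)).
Qed.

Lemma lp_lK : cancel (@lp_l A) (@lp_r A).
Proof.
by move=> a; apply/esym/lp_r_unique; [apply: (lp_mulVl (lpP A) _)|apply: (lp_mullV (lpP A) _)].
Qed.

Lemma lp_rK : cancel (@lp_r A) (@lp_l A).
Proof.
by move=> a; apply/esym/lp_l_unique; [apply: (lp_mulrV (lpP A) _)|apply: (lp_mulVr (lpP A) _)].
Qed.

Lemma lp_l1 : lp_l 1 = 1 :> A.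
Proof. by apply/esym/lp_l_unique; rewrite (lp_mul1 (lpP A)); apply: lp_lexx. Qed.

Lemma lp_r1 : lp_r 1 = 1 :> A.
Proof. by rewrite -{1}lp_l1 lp_lK. Qed.

Lemma lp_lM a b : lp_l (a * b) = lp_l b * lp_l a.
Proof.
apply/esym/lp_l_unique.
- rewrite -(lp_mulA (lpP A)); apply: (lp_le_trans _ (lp_mulVl (lpP A) b)).
  apply: (lp_mul2l (lpP A) _ _); rewrite (lp_mulA (lpP A)).
  by have := lp_mul2r (lpP A) b (lp_mulVl (lpP A) a); rewrite (lp_mul1 (lpP A)).
- rewrite -(lp_mulA (lpP A)); apply: (lp_le_trans (lp_mullV (lpP A) a) _).
  apply: (lp_mul2l (lpP A) _ _); rewrite (lp_mulA (lpP A)).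
  by have := lp_mul2r (lpP A) (lp_l a) (lp_mullV (lpP A) b); rewrite (lp_mul1 (lpP A)).
Qed.

Lemma lp_rM a b : lp_r (a * b) = lp_r b * lp_r a.
Proof. by rewrite -{1}(lp_rK a) -{1}(lp_rK b) -lp_lM lp_lK. Qed.

Lemma lp_l_anti a b : a <= b -> lp_l b <= lp_l a.
Proof.
move=> ab; have := lp_mul2l (lpP A) (lp_l b) (lp_mullV (lpP A) a).
rewrite (lp_mulr1 (lpP A)) (lp_mulA (lpP A)) => /lp_le_trans; apply.
rewrite -{2}[lp_l a](lp_mul1 (lpP A)); apply: (lp_mul2r (lpP A) _ _).
exact: (lp_le_trans (lp_mul2l (lpP A) _ ab) (lp_mulVl (lpP A) b)).
Qed.

Lemma lp_r_anti a b : a <= b -> lp_r b <= lp_r a.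
Proof.
move=> ab; have := lp_mul2r (lpP A) (lp_r b) (lp_mulVr (lpP A) a).
rewrite (lp_mul1 (lpP A)) -(lp_mulA (lpP A)) => /lp_le_trans; apply.
rewrite -{2}[lp_r a](lp_mulr1 (lpP A)); apply: (lp_mul2l (lpP A) _ _).
exact: (lp_le_trans (lp_mul2r (lpP A) _ ab) (lp_mulrV (lpP A) b)).
Qed.

Lemma lp_lI a b : lp_l (a ⊓ b) = lp_l a ⊔ lp_l b.
Proof.
apply: lp_le_anti; last first.
  by apply: lp_leUx; apply: lp_l_anti; [apply: lp_leIl|apply: lp_leIr].
rewrite -[X in _ <= X]lp_rK; apply: lp_l_anti; apply: lp_lexI.
- by rewrite -[X in _ <= X]lp_lK; apply: lp_r_anti; apply: lp_leUl.
- by rewrite -[X in _ <= X]lp_lK; apply: lp_r_anti; apply: lp_leUr.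
Qed.

Lemma lp_rI a b : lp_r (a ⊓ b) = lp_r a ⊔ lp_r b.
Proof.
apply: lp_le_anti; last first.
  by apply: lp_leUx; apply: lp_r_anti; [apply: lp_leIl|apply: lp_leIr].
rewrite -[X in _ <= X]lp_lK; apply: lp_r_anti; apply: lp_lexI.
- by rewrite -[X in _ <= X]lp_rK; apply: lp_l_anti; apply: lp_leUl.
- by rewrite -[X in _ <= X]lp_rK; apply: lp_l_anti; apply: lp_leUr.
Qed.

Lemma lp_lU a b : lp_l (a ⊔ b) = lp_l a ⊓ lp_l b.
Proof. by rewrite -{1}(lp_lK a) -{1}(lp_lK b) -lp_rI lp_rK. Qed.

Lemma lp_rU a b : lp_r (a ⊔ b) = lp_r a ⊓ lp_r b.
Proof. by rewrite -{1}(lp_rK a) -{1}(lp_rK b) -lp_lI lp_lK. Qed.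

End Theory.

Record lp_closed (A : lp_alg) (S : A -> Prop) : Prop := LpClosed {
  lp_closedI : forall x y, S x -> S y -> S (lp_meet x y);
  lp_closedU : forall x y, S x -> S y -> S (lp_join x y);
  lp_closedM : forall x y, S x -> S y -> S (lp_mul x y);
  lp_closed1 : S lp_one;
  lp_closedl : forall x, S x -> S (lp_l x);
  lp_closedr : forall x, S x -> S (lp_r x) }.

Section Subalgebra.
Variables (A : lpregroup) (S : A -> Prop) (hS : lp_closed S).

Definition sub_alg : lp_alg := @LpAlg {x : A | S x}
  (fun x y => exist _ _ (lp_closedI hS (proj2_sig x) (proj2_sig y)))
  (fun x y => exist _ _ (lp_closedU hS (proj2_sig x) (proj2_sig y)))
  (fun x y => exist _ _ (lp_closedM hS (proj2_sig x) (proj2_sig y)))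
  (exist _ _ (lp_closed1 hS))
  (fun x => exist _ _ (lp_closedl hS (proj2_sig x)))
  (fun x => exist _ _ (lp_closedr hS (proj2_sig x))).

Lemma sub_alg_eq (x y : sub_alg) : proj1_sig x = proj1_sig y -> x = y.
Proof.
case: x y => [x hx] [y hy] /= xy; subst y; congr exist; exact: Prop_irrelevance.
Qed.

Lemma sub_alg_le (x y : sub_alg) : lp_le x y <-> lp_le (proj1_sig x) (proj1_sig y).
Proof. by split=> [/(congr1 (@proj1_sig _ _))|h]; [|apply: sub_alg_eq]. Qed.

Lemma sub_algP : lp_axioms sub_alg.
Proof.
have hA := lpP A.
split.
- by move=> x y; apply: sub_alg_eq; apply: (lp_meetC hA).
- by move=> x y; apply: sub_alg_eq; apply: (lp_joinC hA).
- by move=> x y z; apply: sub_alg_eq; apply: (lp_meetA hA).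
- by move=> x y z; apply: sub_alg_eq; apply: (lp_joinA hA).
- by move=> x y; apply: sub_alg_eq; apply: (lp_joinKI hA).
- by move=> x y; apply: sub_alg_eq; apply: (lp_meetKU hA).
- by move=> x y z; apply: sub_alg_eq; apply: (lp_mulA hA).
- by move=> x; apply: sub_alg_eq; apply: (lp_mul1 hA).
- by move=> x; apply: sub_alg_eq; apply: (lp_mulr1 hA).
- by move=> c a b /sub_alg_le h; apply/sub_alg_le; apply: (lp_mul2l hA).
- by move=> c a b /sub_alg_le h; apply/sub_alg_le; apply: (lp_mul2r hA).
- by move=> a; apply/sub_alg_le; apply: (lp_mulVl hA).
- by move=> a; apply/sub_alg_le; apply: (lp_mullV hA).
- by move=> a; apply/sub_alg_le; apply: (lp_mulrV hA).
- by move=> a; apply/sub_alg_le; apply: (lp_mulVr hA).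
Qed.

Definition sub_lp : lpregroup := Lpregroup sub_algP.

End Subalgebra.

Definition lp_periodic (A : lp_alg) (n : nat) (x : A) : Prop :=
  iter n (@lp_l A) x = iter n (@lp_r A) x.

Lemma lp_periodic_closed (A : lpregroup) (n : nat) :
  lp_closed (@lp_periodic A n).
Proof.
have lr x : lp_l (lp_r x) = lp_r (lp_l x) :> A by rewrite lp_rK lp_lK.
have iterl x m : iter m (@lp_r A) (lp_l x) = lp_l (iter m (@lp_r A) x).
  by elim: m => //= m ->; rewrite lr.
have iterr x m : iter m (@lp_l A) (lp_r x) = lp_r (iter m (@lp_l A) x).
  by elim: m => //= m ->; rewrite lr.
have lI m x y : iter m (@lp_l A) (lp_meet x y) =
    (if odd m then @lp_join A else @lp_meet A) (iter m (@lp_l A) x) (iter m (@lp_l A) y).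
  by elim: m => //= m ->; case: (odd m); rewrite /= ?lp_lI ?lp_lU.
have rI m x y : iter m (@lp_r A) (lp_meet x y) =
    (if odd m then @lp_join A else @lp_meet A) (iter m (@lp_r A) x) (iter m (@lp_r A) y).
  by elim: m => //= m ->; case: (odd m); rewrite /= ?lp_rI ?lp_rU.
have lU m x y : iter m (@lp_l A) (lp_join x y) =
    (if odd m then @lp_meet A else @lp_join A) (iter m (@lp_l A) x) (iter m (@lp_l A) y).
  by elim: m => //= m ->; case: (odd m); rewrite /= ?lp_lI ?lp_lU.
have rU m x y : iter m (@lp_r A) (lp_join x y) =
    (if odd m then @lp_meet A else @lp_join A) (iter m (@lp_r A) x) (iter m (@lp_r A) y).
  by elim: m => //= m ->; case: (odd m); rewrite /= ?lp_rI ?lp_rU.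
have lM m x y : iter m (@lp_l A) (lp_mul x y) =
    if odd m then lp_mul (iter m (@lp_l A) y) (iter m (@lp_l A) x)
    else lp_mul (iter m (@lp_l A) x) (iter m (@lp_l A) y).
  by elim: m => //= m ->; case: (odd m); rewrite /= lp_lM.
have rM m x y : iter m (@lp_r A) (lp_mul x y) =
    if odd m then lp_mul (iter m (@lp_r A) y) (iter m (@lp_r A) x)
    else lp_mul (iter m (@lp_r A) x) (iter m (@lp_r A) y).
  by elim: m => //= m ->; case: (odd m); rewrite /= lp_rM.
rewrite /lp_periodic; split=> [x y hx hy|x y hx hy|x y hx hy||x hx|x hx].
- by rewrite lI rI hx hy.
- by rewrite lU rU hx hy.
- by rewrite lM rM hx hy.
- have -> : iter n (@lp_l A) lp_one = lp_one by elim: n => //= n ->; exact: lp_l1.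
  by elim: n => //= n <-; exact/esym/lp_r1.
- by rewrite -iterSr iterS hx iterl.
- by rewrite iterr hx -iterS iterSr.
Qed.

Record FZ_type := FZType {
  FZ_fun :> int -> int;
  FZ_homo : {homo FZ_fun : x y / x <= y};
  FZ_fin : forall x, finite_set (FZ_fun @^-1` [set x]) }.

(* Both default to 0 when S has no least (resp. greatest) element. *)
Definition int_min (S : set int) : int := xget 0 (S `&` lbound S).
Definition int_max (S : set int) : int := xget 0 (S `&` ubound S).

Lemma FZ_eq (f g : FZ_type) : (forall x, f x = g x) -> f = g.
Proof.
case: f g => [f fh ff] [g gh gf] /= fg; have E : f = g by apply/funext.
subst g; congr FZType; exact: Prop_irrelevance.
Qed.

Lemma int_minP (S : set int) (b m : int) : lbound S b -> S m ->
  S (int_min S) /\ lbound S (int_min S).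
Proof.
move=> hb hm; suff: (S `&` lbound S) !=set0 by move/(xgetPex 0).
pose P k := `[< S (b + k%:Z) >].
have toS x : S x -> b + `|x - b|%N%:Z = x by move=> /hb; lia.
have exP : exists k, P k by exists `|m - b|%N; apply/asboolP; rewrite toS.
case: (ex_minnP exP) => k /asboolP hk kmin; exists (b + k%:Z); split=> // x hx.
have /kmin : P `|x - b|%N by apply/asboolP; rewrite toS.
by have := toS x hx; lia.
Qed.

Lemma int_maxP (S : set int) (b m : int) : ubound S b -> S m ->
  S (int_max S) /\ ubound S (int_max S).
Proof.
move=> hb hm; suff: (S `&` ubound S) !=set0 by move/(xgetPex 0).
pose P k := `[< S (b - k%:Z) >].
have toS x : S x -> b - `|b - x|%N%:Z = x by move=> /hb; lia.
have exP : exists k, P k by exists `|b - m|%N; apply/asboolP; rewrite toS.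
case: (ex_minnP exP) => k /asboolP hk kmin; exists (b - k%:Z); split=> // x hx.
have /kmin : P `|b - x|%N by apply/asboolP; rewrite toS.
by have := toS x hx; lia.
Qed.

Lemma finite_int_bounded (S : set int) : finite_set S <->
  exists a b, forall x, S x -> a <= x <= b.
Proof.
split=> [/finite_seqP [s ->]|[a [b hab]]].
  elim: s => [|y s [a [b IH]]]; first by exists 0, 0.
  exists (Num.min a y), (Num.max b y) => x /=; rewrite in_cons => /orP[/eqP->|/IH /=]; lia.
apply: (@sub_finite_set _ _ [set` [seq a + i%:Z | i <- iota 0 `|b - a|%N.+1]]).
  move=> x /hab hx; apply/mapP; exists `|x - a|%N; last by lia.
  by rewrite mem_iota; lia.
exact: finite_seq.
Qed.

Lemma fibres_finite (f : int -> int) : {homo f : x y / x <= y} ->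
  ((forall x, finite_set (f @^-1` [set x])) <->
   (forall q, (exists p, q <= f p) /\ (exists p, f p <= q))).
Proof.
move=> fh; split=> [ff|fu x]; last first.
  apply/finite_int_bounded.
  have [_ [a ha]] := fu (x - 1); have [[b hb] _] := fu (x + 1).
  exists a, b => y /= fy; apply/andP; split; rewrite leNgt; apply/negP => /ltW /fh; lia.
have up p : exists p', p <= p' /\ f p < f p'.
  apply: contrapT => H; have /finite_int_bounded [a [b hab]] := ff (f p).
  have hp : p <= Num.max p (b + 1) by lia.
  have /hab : f (Num.max p (b + 1)) = f p.
    apply/le_anti/andP; split; last exact: fh.
    rewrite leNgt; apply/negP => hlt.
    by apply: H; exists (Num.max p (b + 1)).
  by lia.
have dn p : exists p', p' <= p /\ f p' < f p.
  apply: contrapT => H; have /finite_int_bounded [a [b hab]] := ff (f p).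
  have hp : Num.min p (a - 1) <= p by lia.
  have /hab : f (Num.min p (a - 1)) = f p.
    apply/le_anti/andP; split; first exact: fh.
    rewrite leNgt; apply/negP => hlt.
    by apply: H; exists (Num.min p (a - 1)).
  by lia.
pose c := f 0.
have upn n : exists p, c + n%:Z <= f p.
  elim: n => [|n [p IH]]; first by exists 0; rewrite -/c; lia.
  by have [p' [_ hp']] := up p; exists p'; lia.
have dnn n : exists p, f p <= c - n%:Z.
  elim: n => [|n [p IH]]; first by exists 0; rewrite -/c; lia.
  by have [p' [_ hp']] := dn p; exists p'; lia.
move=> q; split.
- by have [p hp] := upn `|q - c|%N; exists p; lia.
- by have [p hp] := dnn `|q - c|%N; exists p; lia.
Qed.

Lemma FZ_unbounded (f : FZ_type) q : (exists p, q <= f p) /\ (exists p, f p <= q).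
Proof. by have /fibres_finite := @FZ_homo f; move=> [/(_ (@FZ_fin f)) + _]; apply. Qed.

Definition FZ_build (f : int -> int) (fh : {homo f : x y / x <= y})
    (fu : forall q, (exists p, q <= f p) /\ (exists p, f p <= q)) : FZ_type :=
  FZType fh ((fibres_finite fh).2 fu).

Definition fun_l (f : int -> int) (q : int) : int := int_min [set p | q <= f p].
Definition fun_r (f : int -> int) (q : int) : int := int_max [set p | f p <= q].

Lemma fun_lP (f : FZ_type) q : q <= f (fun_l f q) /\ forall p, q <= f p -> fun_l f q <= p.
Proof.
have [[p hp] _] := FZ_unbounded f q; have [_ [b hb]] := FZ_unbounded f (q - 1).
apply: (@int_minP [set p | q <= f p] b p) => //= x /= hx.
by rewrite leNgt; apply/negP => /ltW /(FZ_homo f); lia.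
Qed.

Lemma fun_rP (f : FZ_type) q : f (fun_r f q) <= q /\ forall p, f p <= q -> p <= fun_r f q.
Proof.
have [_ [p hp]] := FZ_unbounded f q; have [[b hb] _] := FZ_unbounded f (q + 1).
apply: (@int_maxP [set p | f p <= q] b p) => //= x /= hx.
by rewrite leNgt; apply/negP => /ltW /(FZ_homo f); lia.
Qed.

Lemma fun_l_le (f : FZ_type) q p : (fun_l f q <= p) = (q <= f p).
Proof.
have [h1 h2] := fun_lP f q; apply/idP/idP => [|/h2 //].
by move=> /(FZ_homo f); apply: le_trans.
Qed.

Lemma le_fun_r (f : FZ_type) q p : (p <= fun_r f q) = (f p <= q).
Proof.
have [h1 h2] := fun_rP f q; apply/idP/idP => [|/h2 //].
by move=> /(FZ_homo f) /le_trans; apply.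
Qed.

Lemma FZ_meet_homo (f g : FZ_type) : {homo f \min g : x y / x <= y}.
Proof. by move=> x y xy /=; have := FZ_homo f xy; have := FZ_homo g xy; lia. Qed.

Lemma FZ_meet_unbounded (f g : FZ_type) q :
  (exists p, q <= (f \min g) p) /\ (exists p, (f \min g) p <= q).
Proof.
have [[p hp] [p' hp']] := FZ_unbounded f q; have [[r hr] _] := FZ_unbounded g q.
split; last by exists p' => /=; lia.
have := @FZ_homo f p (Num.max p r); have := @FZ_homo g r (Num.max p r).
by exists (Num.max p r) => /=; lia.
Qed.

Lemma FZ_join_homo (f g : FZ_type) : {homo f \max g : x y / x <= y}.
Proof. by move=> x y xy /=; have := FZ_homo f xy; have := FZ_homo g xy; lia. Qed.

Lemma FZ_join_unbounded (f g : FZ_type) q :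
  (exists p, q <= (f \max g) p) /\ (exists p, (f \max g) p <= q).
Proof.
have [[p' hp'] [p hp]] := FZ_unbounded f q; have [_ [r hr]] := FZ_unbounded g q.
split; first by exists p' => /=; lia.
have := @FZ_homo f (Num.min p r) p; have := @FZ_homo g (Num.min p r) r.
by exists (Num.min p r) => /=; lia.
Qed.

Lemma FZ_mul_homo (f g : FZ_type) : {homo f \o g : x y / x <= y}.
Proof. by move=> x y xy /=; do 2!apply: FZ_homo. Qed.

Lemma FZ_mul_unbounded (f g : FZ_type) q :
  (exists p, q <= (f \o g) p) /\ (exists p, (f \o g) p <= q).
Proof.
have [[p hp] [r hr]] := FZ_unbounded f q; split.
- have [[p' /(FZ_homo f) hp'] _] := FZ_unbounded g p.
  by exists p' => /=; apply: le_trans hp hp'.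
- have [_ [r' /(FZ_homo f) hr']] := FZ_unbounded g r.
  by exists r' => /=; apply: le_trans hr' hr.
Qed.

Lemma FZ_one_unbounded q : (exists p : int, q <= id p) /\ (exists p, id p <= q).
Proof. by split; exists q. Qed.

Lemma FZ_l_homo (f : FZ_type) : {homo fun_l f : x y / x <= y}.
Proof. by move=> x y xy; rewrite fun_l_le (le_trans xy) // -fun_l_le. Qed.

Lemma FZ_l_unbounded (f : FZ_type) q :
  (exists p, q <= fun_l f p) /\ (exists p, fun_l f p <= q).
Proof.
split; last by exists (f q); rewrite fun_l_le.
exists (f q + 1); rewrite leNgt; apply/negP => /ltW; rewrite fun_l_le; lia.
Qed.

Lemma FZ_r_homo (f : FZ_type) : {homo fun_r f : x y / x <= y}.
Proof. by move=> x y xy; rewrite le_fun_r (le_trans _ xy) // -le_fun_r. Qed.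

Lemma FZ_r_unbounded (f : FZ_type) q :
  (exists p, q <= fun_r f p) /\ (exists p, fun_r f p <= q).
Proof.
split; first by exists (f q); rewrite le_fun_r.
exists (f q - 1); rewrite leNgt; apply/negP => /ltW; rewrite le_fun_r; lia.
Qed.

Definition FZ_alg : lp_alg := @LpAlg FZ_type
  (fun f g => FZ_build (@FZ_meet_homo f g) (FZ_meet_unbounded f g))
  (fun f g => FZ_build (@FZ_join_homo f g) (FZ_join_unbounded f g))
  (fun f g => FZ_build (@FZ_mul_homo f g) (FZ_mul_unbounded f g))
  (FZ_build (fun x y (h : x <= y) => h) FZ_one_unbounded)
  (fun f => FZ_build (@FZ_l_homo f) (FZ_l_unbounded f))
  (fun f => FZ_build (@FZ_r_homo f) (FZ_r_unbounded f)).

Lemma FZ_le (f g : FZ_alg) : lp_le f g <-> forall x, (f : FZ_type) x <= (g : FZ_type) x.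
Proof.
split=> [h x|h]; last by apply: FZ_eq => x /=; have := h x; lia.
by rewrite -h /=; lia.
Qed.

Lemma FZ_axioms : lp_axioms FZ_alg.
Proof.
split; do ?[by move=> *; apply: FZ_eq => x /=; lia].
- by move=> c a b /FZ_le h; apply/FZ_le => x /=; apply: FZ_homo.
- by move=> c a b /FZ_le h; apply/FZ_le => x /=.
- by move=> a; apply/FZ_le => x /=; rewrite fun_l_le.
- by move=> a; apply/FZ_le => x /=; rewrite -fun_l_le.
- by move=> a; apply/FZ_le => x /=; rewrite -le_fun_r.
- by move=> a; apply/FZ_le => x /=; rewrite le_fun_r.
Qed.

Definition FZ : lpregroup := Lpregroup FZ_axioms.

Definition FnZ (n : nat) : lpregroup := sub_lp (lp_periodic_closed FZ n).

Lemma FZ_periodicP (n : nat) (f : FZ_type) :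
  @lp_periodic FZ n f <-> forall x, f (x + n%:Z) = f x + n%:Z.
Proof.
have ll (g : FZ) x : (lp_l (lp_l g) : FZ_type) x = (g : FZ_type) (x - 1) + 1.
  have h p : (fun_l (fun_l g) x <= p) = (g (x - 1) + 1 <= p).
    rewrite (fun_l_le (lp_l g : FZ_type)) -[RHS]negbK -[LHS]negbK -!ltNge /=.
    by have := fun_l_le g p (x - 1); lia.
  by apply/le_anti; rewrite /= h lexx -h lexx.
have lliter (g : FZ) m x :
    (iter (m + m) (@lp_l FZ) g : FZ_type) x = (g : FZ_type) (x - m%:Z) + m%:Z.
  elim: m x => [|m IH] x; first by rewrite /= subr0 addr0.
  by rewrite addSn addnS 2!iterS ll IH (_ : x - 1 - m%:Z = x - m.+1%:Z); lia.
have lrK m (g : FZ) : iter m (@lp_l FZ) (iter m (@lp_r FZ) g) = g.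
  by elim: m => // m IH; rewrite iterSr [iter m.+1 (@lp_r FZ) g]iterS lp_rK IH.
have rlK m (g : FZ) : iter m (@lp_r FZ) (iter m (@lp_l FZ) g) = g.
  by elim: m => // m IH; rewrite iterSr [iter m.+1 (@lp_l FZ) g]iterS lp_lK IH.
rewrite /lp_periodic; split=> [/(congr1 (iter n (@lp_l FZ)))|h].
  rewrite lrK -iterD => E x; have := lliter f n (x + n%:Z).
  by rewrite E addrK.
have E : iter (n + n) (@lp_l FZ) f = f.
  by apply: FZ_eq => x; rewrite lliter -h subrK.
by rewrite -[X in _ = iter n _ X]E iterD rlK.
Qed.

(* Main.v *)
Require Import Defs.
From mathcomp Require Import all_boot all_order all_algebra.
From mathcomp Require Import zify.
From mathcomp Require Import boolp.

(** Let K be the set of the divisors k of n with F_k(Z) in V. What has to be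
    shown is that an equation s = t valid in F_k(Z) for every k in K is valid in
    every member A of V; by hypothesis A satisfies the equations of V and those
    of F_n(Z).

    The rigid part of F_n(Z) is the classification of its subalgebras D by a
    period (subalgebra_period, steps_generate). Take the largest k for which
    some f <= 1 in D fixes 0 and sends k - 1 to 0. Maximality forces every
    f <= 1 in D that fixes y to fix y + k, so the jumps and the images of the
    elements of D are invariant under translation by k, and such maps are
    themselves k-periodic (per_of_jumps_image). Hence D lies in F_k(Z), and f is
    the step function rounding down to a multiple of k. If k > 1 this step
    function generates F_k(Z), so D = F_k(Z).

    Elements of F_n(Z) are unbounded, but up to composition with translations by
    multiples of n there are finitely many of them (finite_shapes), and g^l g
    and g g^r do not see these translations. So, given a valuation v in F_n(Z),
    the classification applies to the algebra D of the elements that are values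
    of one term at all valuations of the shape of v simultaneously. If s = t
    fails at v, then v takes values in F_k(Z) for the period k of D, so k is not
    in K and some equation of V fails in F_k(Z). If k > 1, the failure takes
    place at elements of D, hence at fixed terms; residuation, conjugates and
    powers turn it into a term q that is at least 1 in A while its value at every
    valuation of the shape of v lies below the translation by any prescribed -C
    (bad_shape, deflate). On the other hand, if 1 is in K, the residual t^r s is
    at least 1 in F_1(Z), that is, on translations, and comparing v with the
    valuation by the translations x + v_i(0) gives a bound t^r s >= x - C that is
    uniform in v (residual_bounded_below). The meet of the terms q over
    the finitely many shapes is thus below t^r s in F_n(Z), hence in A, where it
    is at least 1: so 1 <= t^r s, which is t <= s (le_of_periods).

    If 1 is not in K, some equation of V fails among translations. The join of
    the conjugates of an element of F_n(Z) is a translation above it, so the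
    failing equation can be evaluated at arbitrarily large translations built
    from any element, and A is trivial (trivial_of_F1_not_sat). *)

Set Implicit Arguments.
Unset Strict Implicit.
Unset Printing Implicit Defensive.

Import Order.TTheory GRing.Theory Num.Theory.

Local Open Scope ring_scope.

(** * Residuation and terms *)

Section Algebra.
Variable A : lpregroup.
Implicit Types a b : A.

(** Turns an inequality into one of the form 1 <= c, a form stable under the
    operations used to combine consequences of the equations of A. *)
Lemma lp_one_le_residual a b :
  lp_le lp_one (lp_mul (lp_r b) a) <-> lp_le b a.
Proof.
split=> h.
- have := lp_mul2l (lpP A) b h.
  rewrite (lp_mulr1 (lpP A)) (lp_mulA (lpP A)) => /lp_le_trans; apply.
  by have := lp_mul2r (lpP A) a (lp_mulrV (lpP A) b); rewrite (lp_mul1 (lpP A)).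
- exact: lp_le_trans (lp_mulVr (lpP A) b) (lp_mul2l (lpP A) _ h).
Qed.

Lemma lp_one_le_mul a b :
  lp_le lp_one a -> lp_le lp_one b -> lp_le lp_one (lp_mul a b).
Proof.
move=> ha hb; apply: lp_le_trans hb _.
by have := lp_mul2r (lpP A) b ha; rewrite (lp_mul1 (lpP A)).
Qed.

Lemma lp_one_le_ll a : lp_le lp_one a -> lp_le lp_one (lp_l (lp_l a)).
Proof. by move=> h; rewrite -[lp_one]lp_l1 -[lp_one]lp_l1; do 2!apply: lp_l_anti. Qed.

Lemma lp_one_le_rr a : lp_le lp_one a -> lp_le lp_one (lp_r (lp_r a)).
Proof. by move=> h; rewrite -[lp_one]lp_r1 -[lp_one]lp_r1; do 2!apply: lp_r_anti. Qed.

Lemma lp_trivial : (forall a, lp_le a lp_one) -> forall a b, a = b.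
Proof.
move=> h; suff h1 a : a = lp_one by move=> a b; rewrite (h1 a) (h1 b).
apply: lp_le_anti => //; apply: lp_le_trans (lp_mullV (lpP A) a) _.
by have := lp_mul2l (lpP A) a (h (lp_l a)); rewrite (lp_mulr1 (lpP A)).
Qed.

End Algebra.

Lemma lp_eval_closed (A : lp_alg) (D : A -> Prop) (v : nat -> A) t :
  lp_closed D -> (forall i, D (v i)) -> D (lp_eval v t).
Proof.
move=> hD hv; elim: t => //= [s IHs t IHt|s IHs t IHt|s IHs t IHt||t IHt|t IHt].
- exact: lp_closedI. - exact: lp_closedU. - exact: lp_closedM.
- exact: lp_closed1. - exact: lp_closedl. - exact: lp_closedr.
Qed.

(** With terms as an algebra, substitution is evaluation in it. *)
Definition term_alg : lp_alg := LpAlg TMeet TJoin TMul TOne TL TR.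

Definition tsubst (y : nat -> lp_term) (t : lp_term) : lp_term :=
  @lp_eval term_alg y t.

Lemma lp_eval_subst (A : lp_alg) (v : nat -> A) y t :
  lp_eval v (tsubst y t) = lp_eval (fun i => lp_eval v (y i)) t.
Proof. by elim: t => //= [s -> t ->|s -> t ->|s -> t ->|t ->|t ->]. Qed.

Fixpoint var_bound (t : lp_term) : nat :=
  match t with
  | TVar i => i.+1
  | TMeet s t | TJoin s t | TMul s t => maxn (var_bound s) (var_bound t)
  | TOne => 0
  | TL t | TR t => var_bound t
  end.

Lemma lp_eval_ext (A : lp_alg) (v v' : nat -> A) t p : (var_bound t <= p)%N ->
  (forall i, (i < p)%N -> v i = v' i) -> lp_eval v t = lp_eval v' t.
Proof.
move=> + hv; elim: t => [i|s IHs t IHt|s IHs t IHt|s IHs t IHt||t IHt|t IHt] //=.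
- exact: hv.
- by rewrite geq_max => /andP[/IHs -> /IHt ->].
- by rewrite geq_max => /andP[/IHs -> /IHt ->].
- by rewrite geq_max => /andP[/IHs -> /IHt ->].
- by move=> /IHt ->.
- by move=> /IHt ->.
Qed.

Lemma variety_gen_sat (I : Type) (K : I -> lpregroup) (A : lpregroup) e :
  variety_gen K A -> (forall i, lp_sat (K i) e) -> lp_sat A e.
Proof.
move=> /(_ (fun B => lp_sat B e)) h hK; apply: h => //.
exists (eq e) => B; split=> [hB e' <- //|]; exact.
Qed.

(** * Periodic maps *)

Definition per (n : nat) (f : FZ_type) := forall x : int, f (x + n%:Z) = f x + n%:Z.

Lemma per_closed n : @lp_closed FZ (per n).
Proof.
have [hI hU hM h1 hl hr] := lp_periodic_closed FZ n.
split=> [f g|f g|f g||f|f]; rewrite /per -!FZ_periodicP //.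
- exact: hI. - exact: hU. - exact: hM. - exact: hl. - exact: hr.
Qed.

Lemma FnZ_eval n (v : nat -> FnZ n) t :
  proj1_sig (lp_eval v t) = lp_eval (fun i => proj1_sig (v i)) t.
Proof. by elim: t => //= [s -> t ->|s -> t ->|s -> t ->|t ->|t ->]. Qed.

Lemma FnZ_satP n e : lp_sat (FnZ n) e <-> forall v : nat -> FZ,
  (forall i, per n (v i)) -> lp_eval v e.1 = lp_eval v e.2.
Proof.
split=> [h v hv|h v].
- pose v' i : FnZ n := exist (@lp_periodic FZ n) (v i) ((FZ_periodicP n (v i)).2 (hv i)).
  by have := congr1 (@proj1_sig _ _) (h v'); rewrite !FnZ_eval.
- apply: sub_alg_eq; rewrite !FnZ_eval; apply: h => i.
  by apply/FZ_periodicP; apply: proj2_sig.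
Qed.

Lemma perMz n (f : FZ_type) (c x : int) : per n f -> f (x + c * n%:Z) = f x + c * n%:Z.
Proof.
move=> hf; have hN (m : nat) y : f (y + m%:Z * n%:Z) = f y + m%:Z * n%:Z.
  elim: m y => [|m IH] y; first by rewrite !mul0r !addr0.
  by rewrite (_ : y + _ = y + m%:Z * n%:Z + n%:Z) ?hf ?IH; lia.
case: c => m; first exact: hN.
have := hN m.+1 (x + Negz m * n%:Z).
by rewrite (_ : x + _ + _ = x) => [->|]; lia.
Qed.

Lemma per_dvd k n f : (k %| n)%N -> per k f -> per n f.
Proof. by move=> /dvdnP[q ->] hf x; rewrite PoszM perMz. Qed.

(** The double left inverse is conjugation by the translation by 1; this is
    what makes translates available inside any subalgebra. *)
Lemma FZ_llE (f : FZ_type) (x : int) : (@lp_l FZ (@lp_l FZ f) : FZ_type) x = f (x - 1) + 1.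
Proof.
have h p : (fun_l (@lp_l FZ f : FZ_type) x <= p) = (f (x - 1) + 1 <= p).
  rewrite (fun_l_le (@lp_l FZ f : FZ_type)) -[RHS]negbK -[LHS]negbK -!ltNge /=.
  by have := fun_l_le f p (x - 1); lia.
by apply/le_anti; rewrite /= h lexx -h lexx.
Qed.

Lemma FZ_rrE (f : FZ_type) (x : int) : (@lp_r FZ (@lp_r FZ f) : FZ_type) x = f (x + 1) - 1.
Proof.
have := FZ_llE (@lp_r FZ (@lp_r FZ f)) (x + 1).
by rewrite !lp_rK addrK => ->; rewrite addrK.
Qed.

Lemma conj_closed (P : FZ_type -> Prop) (c : int) :
  (forall f, P f -> P (@lp_l FZ (@lp_l FZ f))) ->
  (forall f, P f -> P (@lp_r FZ (@lp_r FZ f))) ->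
  forall f, P f -> exists2 g, P g & forall x : int, g x = f (x - c) + c.
Proof.
move=> hl hr f hf; elim/int_ind: c => [|m [g hg E]|m [g hg E]].
- by exists f => // x; rewrite subr0 addr0.
- exists (@lp_l FZ (@lp_l FZ g)); first exact: hl.
  move=> x; rewrite FZ_llE E (_ : x - 1 - _ = x - m.+1%:Z); lia.
- exists (@lp_r FZ (@lp_r FZ g)); first exact: hr.
  move=> x; rewrite FZ_rrE E (_ : x + 1 - _ = x - - m.+1%:Z); lia.
Qed.

Lemma finite_join (P : FZ_type -> Prop) (F : nat -> FZ_type) m :
  (forall f g, P f -> P g -> P (@lp_join FZ f g)) -> (forall j, P (F j)) ->
  exists2 g : FZ_type, P g & (forall j (x : int), (j <= m)%N -> F j x <= g x) /\
    (forall x y : int, (forall j, (j <= m)%N -> F j x <= y) -> g x <= y).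
Proof.
move=> hP hF; elim: m => [|m [g hg [up lub]]].
  by exists (F 0%N) => //; split=> [j x|x y]; [rewrite leqn0 => /eqP->|apply].
exists (@lp_join FZ g (F m.+1)); first exact: hP.
split=> [j x|x y h] /=.
- rewrite leq_eqVlt => /orP[/eqP->|/up h]; first by lia.
  by have := h x; lia.
- have h1 := h _ (leqnn _); have h2 : g x <= y by apply: lub => j hj; apply/h/leqW.
  by lia.
Qed.

(** The maps g^l g and g g^r are the interior operators that encode the jumps and
    the image of g as their sets of fixed points. *)
Lemma FZ_llmulE (g : FZ_type) (y : int) :
  (@lp_mul FZ (@lp_l FZ g) g : FZ_type) y = y <-> g (y - 1) < g y.
Proof.
rewrite /= -[(_ < _)]negbK -leNgt -(fun_l_le g); split=> [->|h].
- by lia.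
- by have : fun_l g (g y) <= y by [rewrite fun_l_le]; lia.
Qed.

Lemma FZ_mulrE (g : FZ_type) (y : int) :
  (@lp_mul FZ g (@lp_r FZ g) : FZ_type) y = y <-> exists x : int, g x = y.
Proof.
split=> [h|[x <-]] /=; first by exists (fun_r g y).
apply: le_anti; rewrite -le_fun_r lexx /=; apply: FZ_homo.
by rewrite le_fun_r.
Qed.

(** At a jump g and h both move to the next element of their common image, and
    elsewhere both stay put; so h remains strictly ahead of g. *)
Lemma same_jumps_image_lt (g h : FZ_type) (x0 : int) :
  (forall x : int, g (x - 1) < g x -> h (x - 1) < h x) ->
  (forall x : int, exists y : int, h x = g y) ->
  g x0 < h x0 -> forall m : nat, g (x0 + m%:Z) < h (x0 + m%:Z).
Proof.
move=> jump img h0; elim=> [|m IH]; first by rewrite addr0.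
set x := x0 + m.+1%:Z; have Ex : x0 + m%:Z = x - 1 by rewrite /x; lia.
move: IH; rewrite Ex => IH.
have [gx|gx] := ltP (g (x - 1)) (g x); last first.
  by have := @FZ_homo h (x - 1) x; lia.
have hx := jump _ gx; have [y hy] := img (x - 1).
suff gh : g x <= h (x - 1) by apply: le_lt_trans gh hx.
rewrite hy; apply: FZ_homo; rewrite leNgt; apply/negP => yx.
by have := @FZ_homo g y (x - 1); lia.
Qed.

(** If h is a conjugate of g by a translation, staying ahead forever means that
    g gains at least one extra unit on each step by k, which after n steps
    contradicts n-periodicity. *)
Lemma per_shift_not_lt n (g h : FZ_type) (k x0 : int) : (0 < n)%N ->
  per n g -> (forall x : int, h x = g (x + k) - k) ->
  (forall x : int, g x < h x -> forall m : nat, g (x + m%:Z) < h (x + m%:Z)) ->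
  g x0 < h x0 -> False.
Proof.
move=> n0 gn hE lt h0.
have all_lt (x : int) : g x + k + 1 <= g (x + k).
  pose d := `|x - x0|%N.
  have := lt _ h0 (absz (x - x0 + d%:Z * n%:Z)).
  rewrite (_ : x0 + _ = x + d%:Z * n%:Z); last by rewrite /d; clear -n0; nia.
  have g1 := perMz d x gn; have g2 := perMz d (x + k) gn.
  rewrite hE g1 (_ : x + d%:Z * n%:Z + k = x + k + d%:Z * n%:Z) ?g2; lia.
have it (m : nat) : g 0 + m%:Z * (k + 1) <= g (m%:Z * k).
  elim: m => [|m IH]; first by rewrite !mul0r addr0.
  by have := all_lt (m%:Z * k); rewrite (_ : m%:Z * k + k = m.+1%:Z * k); lia.
by have := it n; have := perMz k 0 gn; rewrite add0r mulrC => ->; lia.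
Qed.

Lemma per_shift_closed n k (S : int -> Prop) : (0 < n)%N ->
  (forall x : int, S x <-> S (x + n%:Z)) -> (forall x : int, S x -> S (x + k%:Z)) ->
  forall x : int, S (x + k%:Z) -> S x.
Proof.
move=> n0 hn hk x hx.
have hkm (m : nat) y : S y -> S (y + m%:Z * k%:Z).
  elim: m y => [|m IH] y hy; first by rewrite mul0r addr0.
  by rewrite (_ : y + _ = y + k%:Z + m%:Z * k%:Z); [exact/IH/hk|lia].
have hnm (m : nat) y : S (y + m%:Z * n%:Z) -> S y.
  elim: m y => [|m IH] y; first by rewrite mul0r addr0.
  by rewrite (_ : y + _ = y + n%:Z + m%:Z * n%:Z); [move=> /IH h; apply/hn|lia].
(* Going back by k is going forward n - 1 times by k and back k times by n. *)
apply: (hnm k); have := hkm n.-1 _ hx.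
by rewrite (_ : x + k%:Z + _ = x + k%:Z * n%:Z) //; case: n n0 {hn hnm hx} => // n _ /=; lia.
Qed.

(** The conjugate of g by the translation by k has the jumps and the image of g,
    so neither of the two maps can be ahead of the other. *)
Lemma per_of_jumps_image n k (g : FZ_type) : (0 < n)%N -> per n g ->
  (forall x : int, g (x - 1) < g x -> g (x + k%:Z - 1) < g (x + k%:Z)) ->
  (forall y : int, (exists x : int, g x = y) -> exists x : int, g x = y + k%:Z) ->
  per k g.
Proof.
move=> n0 gn jump img.
have jump' : forall x : int, g (x + k%:Z - 1) < g (x + k%:Z) -> g (x - 1) < g x.
  apply: (per_shift_closed (S := fun x : int => g (x - 1) < g x) n0) => // x.
  by rewrite addrAC !gn ltrD2r.
have img' : forall y : int, (exists x : int, g x = y + k%:Z) -> exists x : int, g x = y.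
  apply: (per_shift_closed (S := fun y : int => exists x : int, g x = y) n0) => // y; split.
    by case=> x <-; exists (x + n%:Z).
  by case=> x E; exists (x - n%:Z); have := gn (x - n%:Z); rewrite subrK E; lia.
have [h _ hE] := @conj_closed xpredT (- k%:Z) (fun _ _ => isT) (fun _ _ => isT) g isT.
have {}hE (x : int) : h x = g (x + k%:Z) - k%:Z by rewrite hE opprK.
move=> x; suff : h x = g x by rewrite hE; lia.
apply/eqP; rewrite eq_le !leNgt; apply/andP; split; apply/negP => lt_x.
- apply: (@per_shift_not_lt n g h k%:Z x) => // x1.
  apply: same_jumps_image_lt => y; first by move/jump; rewrite !hE (_ : y - 1 + k%:Z = y + k%:Z - 1); lia.
  by have [|z <-] := img' (h y); [exists (y + k%:Z); rewrite hE; lia|exists z].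
- have hn : per n h by move=> y; rewrite !hE (_ : y + n%:Z + k%:Z = y + k%:Z + n%:Z) ?gn; lia.
  apply: (@per_shift_not_lt n h g (- k%:Z) x) => //.
    by move=> y; rewrite hE subrK opprK; lia.
  move=> x1; apply: same_jumps_image_lt => y.
    by have := jump' y; rewrite !hE (_ : y - 1 + k%:Z = y + k%:Z - 1); lia.
  have [|z hz] := img (g y); first by exists y.
  by exists (z - k%:Z); rewrite hE subrK hz addrK.
Qed.

(** * The period of a subalgebra *)

Section Period.
Variables (n : nat) (D : FZ_type -> Prop).
Hypotheses (n0 : (0 < n)%N) (hD : @lp_closed FZ D) (Dn : forall f, D f -> per n f).

Lemma conj_mem (c : int) f : D f -> exists2 g, D g & forall x : int, g x = f (x - c) + c.
Proof.
apply: conj_closed => g hg; first by do 2!apply: (lp_closedl hD).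
by do 2!apply: (lp_closedr hD).
Qed.

Definition below1 (f : FZ_type) := D f /\ forall x : int, f x <= x.

(** If g <= 1 in D fixes 0 but not k, then f g, with f the witness for k,
    collapses one more point to 0; this contradicts the choice of k. Any other
    fixed point is moved to 0 by conjugation. *)
Lemma max_collapse : exists k : nat, [/\ (0 < k)%N,
  exists2 f, below1 f & f 0 = 0 /\ f (k%:Z - 1) = 0 &
  forall f (y : int), below1 f -> f y = y -> f (y + k%:Z) = y + k%:Z].
Proof.
pose P k := `[< (0 < k)%N /\ exists2 f, below1 f & f 0 = 0 /\ f (k%:Z - 1) = 0 >].
have exP : exists k, P k.
  exists 1%N; apply/asboolP; split=> //; exists (@lp_one FZ) => //.
  by split=> //; apply: (lp_closed1 hD).
have ubP k : P k -> (k <= n)%N.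
  move=> /asboolP[_ [f [Df f1] [f0 fk]]]; rewrite leqNgt; apply/negP => nk.
  have := Dn Df 0; rewrite f0 !add0r => fn.
  by have := @FZ_homo f n%:Z (k%:Z - 1); lia.
case: (ex_maxnP exP ubP) => k /asboolP[k0 [f [Df f1] [f0 fk]]] kmax.
exists k; split=> //; first by exists f.
suff H g : below1 g -> g 0 = 0 -> g k%:Z = k%:Z.
  move=> g y [Dg g1] gy; have [h Dh hE] := conj_mem (- y) Dg.
  have := H h; rewrite !hE opprK add0r gy subrr (_ : k%:Z + y = y + k%:Z); last by lia.
  move=> E; have : g (y + k%:Z) - y = k%:Z; last by lia.
  apply: E => //; split=> // x; rewrite hE; have := g1 (x - - y); lia.
move=> [Dg g1] g0; apply/eqP; rewrite eq_le g1 leNgt; apply/negP => gk.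
suff /kmax : P k.+1 by rewrite ltnn.
apply/asboolP; split=> //; exists (@lp_mul FZ f g) => /=.
  by split; [apply: (lp_closedM hD)|move=> x /=; apply: le_trans (f1 _) (g1 _)].
rewrite g0 f0; split=> //; rewrite (_ : _ - 1 = k%:Z); last by lia.
have := @FZ_homo g 0 k%:Z; have := @FZ_homo f 0 (g k%:Z).
by have := @FZ_homo f (g k%:Z) (k%:Z - 1); lia.
Qed.

Lemma below1_llmul (g : FZ_type) : D (@lp_mul FZ (@lp_l FZ g) g) ->
  below1 (@lp_mul FZ (@lp_l FZ g) g).
Proof. by split=> //; apply: (FZ_le _ (@lp_one FZ)).1 (lp_mulVl (lpP FZ) g). Qed.

Lemma below1_mulr (g : FZ_type) : D (@lp_mul FZ g (@lp_r FZ g)) ->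
  below1 (@lp_mul FZ g (@lp_r FZ g)).
Proof. by split=> //; apply: (FZ_le _ (@lp_one FZ)).1 (lp_mulrV (lpP FZ) g). Qed.

(** The third clause speaks of maps g that may lie outside D: the values of a
    valuation need not be uniform in the sense below, but their g^l g and g g^r
    are. Applied to the elements of D, it says that D lies in F_k(Z). *)
Lemma subalgebra_period : exists k : nat, [/\ (0 < k)%N, (k %| n)%N,
  forall g, per n g -> D (@lp_mul FZ (@lp_l FZ g) g) ->
    D (@lp_mul FZ g (@lp_r FZ g)) -> per k g &
  exists2 f, D f & forall x : int, 0 <= x < k%:Z -> f x = 0].
Proof.
have [k [k0 [f [Df f1] [f0 fk]] hk]] := max_collapse.
have perk g : per n g -> D (@lp_mul FZ (@lp_l FZ g) g) ->
    D (@lp_mul FZ g (@lp_r FZ g)) -> per k g.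
  move=> gn /below1_llmul D1 /below1_mulr D2.
  apply: (per_of_jumps_image n0) => // x.
  - by move=> /FZ_llmulE /(hk _ _ D1) /FZ_llmulE.
  - by move=> /FZ_mulrE /(hk _ _ D2) /FZ_mulrE.
have f_k : per k f.
  apply: perk; first exact: Dn.
  - by apply: (lp_closedM hD) => //; apply: (lp_closedl hD).
  - by apply: (lp_closedM hD) => //; apply: (lp_closedr hD).
have fz x : 0 <= x < k%:Z -> f x = 0.
  move=> hx; have := @FZ_homo f 0 x; have := @FZ_homo f x (k%:Z - 1).
  by lia.
exists k; split=> //; last by exists f.
have fn : f n%:Z = n%:Z by have := Dn Df 0; rewrite f0 !add0r.
have := perMz (n %/ k)%:Z (n %% k)%:Z f_k.
rewrite -PoszM -PoszD addnC -divn_eq fn fz; last by have := ltn_pmod n k0; lia.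
by rewrite add0r => -[->]; apply: dvdn_mull.
Qed.

End Period.

(** * Translations and steps generate *)

Lemma trans_homo (d : int) : {homo (fun x : int => x + d) : x y / x <= y}.
Proof. by move=> x y; rewrite lerD2r. Qed.

Lemma trans_unbounded (d q : int) :
  (exists p, q <= p + d) /\ (exists p, p + d <= q).
Proof. by split; exists (q - d); rewrite subrK. Qed.

Definition trans (d : int) : FZ_type := FZ_build (@trans_homo d) (trans_unbounded d).

Lemma trans_l (d : int) : @lp_l FZ (trans d) = trans (- d).
Proof.
apply: FZ_eq => x; apply/eqP; rewrite eq_le /= (fun_l_le (trans d)) /= subrK lexx /=.
by have [] := fun_lP (trans d) x; rewrite /=; lia.
Qed.

Lemma trans_r (d : int) : @lp_r FZ (trans d) = trans (- d).
Proof. by have := @lp_lK FZ (trans (- d)); rewrite trans_l opprK. Qed.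

Lemma trans_mul (c d : int) : @lp_mul FZ (trans c) (trans d) = trans (c + d).
Proof. by apply: FZ_eq => x /=; lia. Qed.

Lemma per_trans n (d : int) : per n (trans d).
Proof. by move=> x /=; lia. Qed.

Lemma per1_trans (f : FZ_type) : per 1 f -> f = trans (f 0).
Proof. by move=> hf; apply: FZ_eq => x; have := perMz x 0 hf; rewrite add0r mulr1 /=; lia. Qed.

Lemma per_window k (f g : FZ_type) : (0 < k)%N -> per k f -> per k g ->
  (forall x : int, 0 <= x < k%:Z -> f x = g x) -> f = g.
Proof.
move=> k0 hf hg h; apply: FZ_eq => x.
have := perMz (x %/ k%:Z)%Z (x %% k%:Z)%Z hf; have := perMz (x %/ k%:Z)%Z (x %% k%:Z)%Z hg.
rewrite addrC -divz_eq => -> ->; rewrite h //.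
by rewrite modz_ge0 ?ltz_pmod //; lia.
Qed.

(** Write st m for the conjugate of the step function that is constant equal to
    m on [m, m + k). Then x - 1 is the join over m of st (m - 1) st m: this uses
    k > 1, as st (m - 1) fixes m when k = 1. Once translations are present, any
    g in F_k(Z) is the join over 0 <= m < k of the k-periodic maps equal to g m on
    [m, m + k), which are translates of st m. *)
Lemma steps_generate k (D : FZ_type -> Prop) (s : FZ_type) :
  @lp_closed FZ D -> (1 < k)%N -> D s -> per k s ->
  (forall x : int, 0 <= x < k%:Z -> s x = 0) -> forall g, per k g -> D g.
Proof.
move=> hD k1 Ds sk s0.
pose P f := D f /\ per k f.
have hP : @lp_closed FZ P.
  have [? ? ? ? ? ?] := hD; have [? ? ? ? ? ?] := per_closed k.
  by split=> [f g [? ?] [? ?]|f g [? ?] [? ?]|f g [? ?] [? ?]||f [? ?]|f [? ?]]; split; auto.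
have /choice [st hst] : forall m : int, exists f : FZ_type,
    P f /\ forall x : int, m <= x < m + k%:Z -> f x = m.
  move=> m.
  have [g hg gE] := @conj_closed P m
    (fun f hf => lp_closedl hP (lp_closedl hP hf))
    (fun f hf => lp_closedr hP (lp_closedr hP hf)) s (conj Ds sk).
  by exists g; split=> // x hx; rewrite gE s0; lia.
have st_lo (m x : int) : m - k%:Z <= x < m -> st m x = m - k%:Z.
  move=> hx; have [[_ pm] hm] := hst m.
  by have := pm x; rewrite hm; lia.
have st_hi (m x : int) : m <= x < m + k%:Z -> st m x = m by case: (hst m) => _; apply.
have D1 : P (trans (- 1)).
  have [f Pf [up lub]] := @finite_join P (fun j => @lp_mul FZ (st (j%:Z - 1)) (st j%:Z)) k.-1
    (lp_closedU hP) (fun j => lp_closedM hP (hst _).1 (hst _).1).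
  suff -> : trans (- 1) = f by [].
  apply: (per_window (ltnW k1)) => //; first exact: per_trans.
    by case: Pf.
  move=> x hx /=; apply/eqP; rewrite eq_le; apply/andP; split.
    have := up (absz x) x; rewrite /= (st_hi _ x) ?st_hi; lia.
  apply: lub => j hj /=; have [jx|xj] := leP j%:Z x.
    by rewrite (st_hi _ x) ?st_hi; lia.
  by rewrite (st_lo _ x) ?st_lo; lia.
have Dt (d : int) : P (trans d).
  have Dp : P (trans 1) by have := lp_closedr hP D1; rewrite trans_r opprK.
  elim/int_ind: d => [|m IH|m IH].
  - have -> : trans 0 = @lp_one FZ by apply: FZ_eq => x /=; lia.
    exact: (lp_closed1 hP).
  - have -> : trans m.+1%:Z = @lp_mul FZ (trans m%:Z) (trans 1) by rewrite trans_mul; congr trans; lia.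
    exact: (lp_closedM hP IH Dp).
  - have -> : trans (- m.+1%:Z) = @lp_mul FZ (trans (- m%:Z)) (trans (- 1)) by rewrite trans_mul; congr trans; lia.
    exact: (lp_closedM hP IH D1).
move=> g gk.
have [f Pf [up lub]] := @finite_join P (fun j => @lp_mul FZ (trans (g j%:Z - j%:Z)) (st j%:Z)) k.-1
    (lp_closedU hP) (fun j => lp_closedM hP (Dt _) (hst _).1).
suff -> : g = f by case: Pf.
apply: (per_window (ltnW k1)) => //; first by case: Pf.
move=> x hx /=; apply/eqP; rewrite eq_le; apply/andP; split.
  by have := up (absz x) x; rewrite /= (_ : (absz x)%:Z = x) ?(st_hi _ x); lia.
apply: lub => j hj /=; have [jx|xj] := leP j%:Z x.
  by rewrite (st_hi _ x); [have := FZ_homo g jx; lia|lia].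
have := gk (j%:Z - k%:Z); have := @FZ_homo g (j%:Z - k%:Z) x.
by rewrite (st_lo _ x) ?subrK; lia.
Qed.

(** * Uniform bounds and finitely many shapes *)

Lemma meet_below (P : FZ_type -> Prop) (F : nat -> FZ_type) m :
  (forall f g, P f -> P g -> P (@lp_meet FZ f g)) -> (forall j, P (F j)) ->
  exists2 g : FZ_type, P g & forall j (x : int), (j <= m)%N -> g x <= F j x.
Proof.
move=> hP hF; elim: m => [|m [g hg low]].
  by exists (F 0%N) => // j x; rewrite leqn0 => /eqP->.
exists (@lp_meet FZ g (F m.+1)); first exact: hP.
move=> j x /=; rewrite leq_eqVlt => /orP[/eqP->|/low h]; first by lia.
by have := h x; lia.
Qed.

Lemma per_near_trans n (f : FZ_type) (x : int) : (0 < n)%N -> per n f ->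
  f x <= f 0 + x + n%:Z /\ f 0 + x <= f x + n%:Z.
Proof.
move=> n0 fn; pose r := (x %% n%:Z)%Z; pose q : int := (x %/ n%:Z)%Z * n%:Z.
have E : r + q = x by rewrite addrC /r /q -divz_eq.
have fE : f x = f r + q by rewrite -E perMz.
have r0 : 0 <= r by apply: modz_ge0; lia.
have rn : r <= n%:Z by apply/ltW/ltz_pmod; lia.
have := @FZ_homo f 0 r; have := @FZ_homo f r n%:Z; have := fn 0; rewrite add0r.
by move: (r) (q) E fE r0 rn => a b; lia.
Qed.

Definition close (C : nat) (f g : FZ_type) :=
  forall x : int, f x <= g x + C%:Z /\ g x <= f x + C%:Z.

(** Errors propagate through a term with a bound independent of the valuations:
    an n-periodic map increases by C * n over a length C * n, so it sends points
    at distance at most C to points at distance at most C * n. *)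
Lemma eval_close n t : (0 < n)%N -> exists C : nat, forall v v' : nat -> FZ,
  (forall i, per n (v i)) -> (forall i, per n (v' i)) ->
  (forall i, close n (v i) (v' i)) -> close C (lp_eval v t) (lp_eval v' t).
Proof.
move=> n0.
have pev (v : nat -> FZ) u : (forall i, per n (v i)) -> per n (lp_eval v u).
  exact: lp_eval_closed (per_closed n).
(* One bound suffices, as the two valuations play symmetric roles; the inverses
   need the induction hypothesis with v and v' exchanged. *)
suff [C hC] : exists C : nat, forall v v' : nat -> FZ,
    (forall i, per n (v i)) -> (forall i, per n (v' i)) ->
    (forall i, close n (v i) (v' i)) -> forall x : int,
    (lp_eval v t : FZ_type) x <= (lp_eval v' t : FZ_type) x + C%:Z.
  exists C => v v' hv hv' h x; split; apply: hC => // i y.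
  by have [? ?] := h i y.
elim: t => [i|s [C IHs] t [C' IHt]|s [C IHs] t [C' IHt]|s [C IHs] t [C' IHt]||t [C IHt]|t [C IHt]].
- by exists n => v v' hv hv' h x; have [] := h i x.
- exists (maxn C C') => v v' hv hv' h x.
  by have := IHs _ _ hv hv' h x; have := IHt _ _ hv hv' h x => /=; lia.
- exists (maxn C C') => v v' hv hv' h x.
  by have := IHs _ _ hv hv' h x; have := IHt _ _ hv hv' h x => /=; lia.
- exists (C + C' * n)%N => v v' hv hv' h x.
  pose f : FZ_type := lp_eval v s; pose f' : FZ_type := lp_eval v' s.
  pose g : FZ_type := lp_eval v t; pose g' := (lp_eval v' t : FZ_type) x.
  change (f (g x) <= f' g' + (C + C' * n)%N%:Z).
  have h1 := IHs _ _ hv hv' h g'; have h2 := IHt _ _ hv hv' h x.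
  have h3 := perMz C'%:Z g' (pev v s hv : per n f).
  have h4 : C'%:Z <= C'%:Z * n%:Z by clear -n0; nia.
  rewrite -/f -/f' in h1; rewrite -/g -/g' in h2.
  have : f (g x) <= f (g' + C'%:Z * n%:Z) by apply: FZ_homo; lia.
  by rewrite h3; lia.
- by exists 0%N => v v' hv hv' h x /=; lia.
- exists (C * n)%N => v v' hv hv' h x.
  pose f : FZ_type := lp_eval v t; pose f' : FZ_type := lp_eval v' t.
  change (fun_l f x <= fun_l f' x + (C * n)%N%:Z).
  have hs i : close n (v' i) (v i) by move=> y; have [? ?] := h i y.
  have [h1 _] := fun_lP f' x; rewrite fun_l_le.
  have h2 := IHt _ _ hv' hv hs (fun_l f' x).
  have h3 := perMz C%:Z (fun_l f' x) (pev v t hv : per n f).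
  have h4 : C%:Z <= C%:Z * n%:Z by clear -n0; nia.
  by rewrite PoszM h3; rewrite -/f -/f' in h2; lia.
- exists (C * n)%N => v v' hv hv' h x.
  pose f : FZ_type := lp_eval v t; pose f' : FZ_type := lp_eval v' t.
  change (fun_r f x <= fun_r f' x + (C * n)%N%:Z).
  have hs i : close n (v' i) (v i) by move=> y; have [? ?] := h i y.
  have [h1 _] := fun_rP f x.
  have h2 := IHt _ _ hv' hv hs (fun_r f x).
  have h3 := perMz (- C%:Z) (fun_r f x) (pev v' t hv' : per n f').
  have h4 : C%:Z <= C%:Z * n%:Z by clear -n0; nia.
  suff : fun_r f x + - C%:Z * n%:Z <= fun_r f' x by lia.
  by rewrite le_fun_r h3; rewrite -/f -/f' in h2; lia.
Qed.

Definition same_shape n p (v v' : nat -> FZ_type) :=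
  forall i, (i < p)%N -> exists c : int, forall x : int, v' i x = v i x + c * n%:Z.

Lemma finite_shapes n p : (0 < n)%N ->
  exists (T : finType) (sh : (nat -> FZ_type) -> T), forall v v',
    (forall i, per n (v i)) -> (forall i, per n (v' i)) -> sh v = sh v' ->
    same_shape n p v v'.
Proof.
move=> n0.
(* A map f is recorded by its values on [0, n) after moving f 0 into [0, n);
   by periodicity these values are then at most f 0 + n < 2 n. *)
pose q (f : FZ_type) := (f 0 %/ n%:Z)%Z.
pose r (f : FZ_type) (x : int) := absz (f x - q f * n%:Z)%R.
exists {ffun 'I_p -> {ffun 'I_n -> 'I_(2 * n).+1}}.
exists (fun v => [ffun i : 'I_p => [ffun x : 'I_n => inord (r (v i) (x : nat)%:Z)]]).
move=> v v' hv hv' E i ip; exists (q (v' i) - q (v i)).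
have rE (f : FZ_type) (x : nat) : per n f -> (x < n)%N ->
    (r f x%:Z <= 2 * n)%N /\ (r f x%:Z)%:Z = f x%:Z - q f * n%:Z.
  move=> fn xn; have E0 := divz_eq (f 0) n%:Z.
  have r0 : 0 <= (f 0 %% n%:Z)%Z by apply: modz_ge0; lia.
  have rn : (f 0 %% n%:Z)%Z < n%:Z by apply: ltz_pmod; lia.
  have := @FZ_homo f 0 x%:Z; have := @FZ_homo f x%:Z n%:Z; have := fn 0.
  by rewrite add0r /r /q; move: (_ * _) E0 => y E0; lia.
suff Ef : v' i = @lp_mul FZ (trans ((q (v' i) - q (v i)) * n%:Z)) (v i).
  by move=> x; rewrite {1}Ef.
apply: (per_window n0) => //.
  by apply: (lp_closedM (per_closed n)) => //; apply: per_trans.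
case=> // x /= xn.
have := congr1 (fun F : {ffun 'I_p -> {ffun 'I_n -> 'I_(2 * n).+1}} => F (Ordinal ip) (Ordinal xn)) E.
rewrite !ffunE /= => /(congr1 (@nat_of_ord _)).
have [b1 e1] := rE _ _ (hv i) xn; have [b2 e2] := rE _ _ (hv' i) xn.
rewrite !inordK ?ltnS // => e3; move: e1 e2; rewrite -e3 => -> e.
by rewrite mulrBl; move: (q _ * _) (q _ * _) e => a b; lia.
Qed.

(** The predicate Q restricts the terms that may be used: either all terms, or
    those that are at least 1 in a given algebra. *)
Definition uniform n p (v : nat -> FZ_type) (Q : lp_term -> Prop) (f : FZ_type) :=
  exists2 t, Q t & forall v' : nat -> FZ, (forall i, per n (v' i)) ->
    same_shape n p v v' -> lp_eval v' t = f.

Lemma uniform_closed n p v : @lp_closed FZ (uniform n p v (fun=> True)).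
Proof.
split=> [f g [s _ hs] [t _ ht]|f g [s _ hs] [t _ ht]|f g [s _ hs] [t _ ht]||f [t _ ht]|f [t _ ht]].
- by exists (TMeet s t) => // v' h1 h2 /=; rewrite hs ?ht.
- by exists (TJoin s t) => // v' h1 h2 /=; rewrite hs ?ht.
- by exists (TMul s t) => // v' h1 h2 /=; rewrite hs ?ht.
- by exists TOne.
- by exists (TL t) => // v' h1 h2 /=; rewrite ht.
- by exists (TR t) => // v' h1 h2 /=; rewrite ht.
Qed.

Lemma same_shape_refl n p v : same_shape n p v v.
Proof. by move=> i _; exists 0 => x; rewrite mul0r addr0. Qed.

Lemma uniform_per n p v Q f : (forall i, per n (v i)) -> uniform n p v Q f -> per n f.
Proof.
move=> hv [t _ h]; rewrite -(h v hv (@same_shape_refl n p v)).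
exact: (lp_eval_closed _ (per_closed n)).
Qed.

Lemma trans_llmul (c : int) (f : FZ_type) :
  @lp_mul FZ (@lp_l FZ (@lp_mul FZ (trans c) f)) (@lp_mul FZ (trans c) f)
  = @lp_mul FZ (@lp_l FZ f) f.
Proof.
have -> : @lp_l FZ (@lp_mul FZ (trans c) f) = @lp_mul FZ (@lp_l FZ f) (trans (- c)).
  by rewrite -trans_l; apply: lp_lM.
by apply: FZ_eq => x /=; congr fun_l; lia.
Qed.

Lemma trans_mulr (c : int) (f : FZ_type) (x : int) :
  (@lp_mul FZ (@lp_mul FZ (trans c) f) (@lp_r FZ (@lp_mul FZ (trans c) f)) : FZ_type) x
  = (@lp_mul FZ f (@lp_r FZ f) : FZ_type) (x - c) + c.
Proof.
have -> : @lp_r FZ (@lp_mul FZ (trans c) f) = @lp_mul FZ (@lp_r FZ f) (trans (- c)).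
  by rewrite -trans_r; apply: lp_rM.
by [].
Qed.

Lemma same_shape_trans n p v v' i : same_shape n p v v' -> (i < p)%N ->
  exists c : int, v' i = @lp_mul FZ (trans (c * n%:Z)) (v i).
Proof. by move=> h /h [c hc]; exists c; apply: FZ_eq. Qed.

Lemma uniform_llmul n p (v : nat -> FZ_type) i : (i < p)%N ->
  uniform n p v (fun=> True) (@lp_mul FZ (@lp_l FZ (v i)) (v i)).
Proof.
move=> ip; exists (TMul (TL (TVar i)) (TVar i)) => // v' _ /same_shape_trans /(_ ip) [c /=].
by move=> ->; apply: trans_llmul.
Qed.

Lemma uniform_mulr n p (v : nat -> FZ_type) i : (i < p)%N -> per n (v i) ->
  uniform n p v (fun=> True) (@lp_mul FZ (v i) (@lp_r FZ (v i))).
Proof.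
move=> ip vn; exists (TMul (TVar i) (TR (TVar i))) => // v' _ /same_shape_trans /(_ ip) [c /=].
move=> ->; apply: FZ_eq => x; rewrite trans_mulr -mulNr perMz ?mulNr ?subrK //.
by apply: (lp_closedM (per_closed n)) => //; apply: (lp_closedr (per_closed n)).
Qed.

(** * Terms that separate *)

Section Deflation.
Variables (A : lpregroup) (n p : nat) (v : nat -> FZ_type).
Hypotheses (n0 : (0 < n)%N).

Definition above1 (t : lp_term) := forall u : nat -> A, lp_le lp_one (lp_eval u t).

Let P := uniform n p v above1.

Lemma above1_meet f g : P f -> P g -> P (@lp_meet FZ f g).
Proof.
move=> [s hs es] [t ht et]; exists (TMeet s t) => [u|v' h1 h2]; first exact: lp_lexI.
by rewrite /= es ?et.
Qed.

Lemma above1_mul f g : P f -> P g -> P (@lp_mul FZ f g).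
Proof.
move=> [s hs es] [t ht et]; exists (TMul s t) => [u|v' h1 h2]; first exact: lp_one_le_mul.
by rewrite /= es ?et.
Qed.

Lemma above1_ll f : P f -> P (@lp_l FZ (@lp_l FZ f)).
Proof.
move=> [t ht et]; exists (TL (TL t)) => [u|v' h1 h2]; first exact: lp_one_le_ll.
by rewrite /= et.
Qed.

Lemma above1_rr f : P f -> P (@lp_r FZ (@lp_r FZ f)).
Proof.
move=> [t ht et]; exists (TR (TR t)) => [u|v' h1 h2]; first exact: lp_one_le_rr.
by rewrite /= et.
Qed.

Lemma above1_one : P (@lp_one FZ).
Proof. by exists TOne => // u; apply: lp_lexx. Qed.

(** The meet of the conjugates of h by 0, ..., n - 1 moves every point down,
    because one of them moves it as h moves x0; its C-th power then moves every
    point down by C. *)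
Lemma deflate h (x0 : int) (C : nat) : P h -> per n h -> h x0 < x0 ->
  exists2 g, P g & forall x : int, g x <= x - C%:Z.
Proof.
move=> Ph hn hx0.
have /choice [F hF] : forall j : nat, exists g : FZ_type,
    P g /\ forall x : int, g x = h (x - j%:Z) + j%:Z.
  move=> j; have [g Pg gE] := conj_closed j%:Z above1_ll above1_rr Ph.
  by exists g.
have [g Pg low] := meet_below n.-1 above1_meet (fun j => (hF j).1).
have g1 (x : int) : g x <= x - 1.
  pose j := absz ((x - x0) %% n%:Z)%Z; pose q : int := ((x - x0) %/ n%:Z)%Z.
  have jE : j%:Z = ((x - x0) %% n%:Z)%Z by rewrite /j gez0_abs // modz_ge0 //; lia.
  have jn : (j < n)%N by rewrite -ltz_nat jE ltz_pmod //; lia.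
  have E : x - x0 = q * n%:Z + j%:Z by rewrite jE /q -divz_eq.
  have := low j x; rewrite (hF j).2 (_ : x - j%:Z = x0 + q * n%:Z); last by lia.
  have -> : h (x0 + q * n%:Z) = h x0 + q * n%:Z by exact: perMz.
  by move: (q * n%:Z) E => y; lia.
elim: C => [|C [f Pf fC]].
  by exists (@lp_one FZ); [exact: above1_one|move=> x /=; lia].
exists (@lp_mul FZ g f); first exact: above1_mul.
by move=> x /=; have := g1 (f x); have := fC x; lia.
Qed.

End Deflation.

(** The algebra of the translations of the integers, with the translation by d
    written d. *)
Definition int_alg : lp_alg := @LpAlg int Order.min Order.max (fun x y => x + y) 0 -%R -%R.

(** For N >= 0, multiplication by N is an endomorphism of the integers. *)
Lemma eval_trans (N : nat) (c : nat -> int) t :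
  @lp_eval FZ (fun i => trans (N%:Z * c i)) t = trans (N%:Z * @lp_eval int_alg c t).
Proof.
elim: t => //= [s -> t ->|s -> t ->|s -> t ->||t ->|t ->].
- by apply: FZ_eq => x /=; rewrite -addr_minr minr_pMr.
- by apply: FZ_eq => x /=; rewrite -addr_maxr maxr_pMr.
- by rewrite mulrDr; apply: trans_mul.
- by apply: FZ_eq => x /=; rewrite mulr0 addr0.
- by rewrite mulrN; apply: trans_l.
- by rewrite mulrN; apply: trans_r.
Qed.

(** The join of the first n + 1 conjugates of x v 1, obtained by iterating
    q |-> q v q^ll. On an n-periodic map this joins all its conjugates, so the
    result commutes with the translation by 1. *)
Definition hull_term (n : nat) : lp_term :=
  iter n (fun q => TJoin q (TL (TL q))) (TJoin (TVar 0) TOne).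

Lemma hull_term_trans n (v : nat -> FZ) : (0 < n)%N -> per n (v 0%N) ->
  exists N : nat, lp_eval v (hull_term n) = trans N%:Z /\
    forall x : int, (v 0%N : FZ_type) x <= x + N%:Z.
Proof.
move=> n0 v0n.
pose f : FZ_type := @lp_join FZ (v 0%N) (@lp_one FZ).
have fn : per n f by apply: (lp_closedU (per_closed n)) => //; apply: (lp_closed1 (per_closed n)).
pose F m : FZ_type := @lp_eval FZ v (iter m (fun q => TJoin q (TL (TL q))) (TJoin (TVar 0) TOne)).
have FS m (x : int) : F m.+1 x = Num.max (F m x) (F m (x - 1) + 1).
  by rewrite -FZ_llE.
have FE m (x y : int) : F m x <= y <-> forall j : nat, (j <= m)%N -> f (x - j%:Z) + j%:Z <= y.
  elim: m x y => [|m IH] x y.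
    split=> [h j|h]; last by have := h 0%N (leqnn _); rewrite subr0 addr0.
    by rewrite leqn0 => /eqP ->; rewrite subr0 addr0.
  rewrite FS ge_max; split=> [/andP[/IH h1 h2] j|h].
    case: j => [|j] hj; first exact: h1.
    have /IH /(_ j hj) : F m (x - 1) <= y - 1 by lia.
    by rewrite (_ : x - 1 - j%:Z = x - j.+1%:Z); lia.
  apply/andP; split; first by apply/IH => j hj; apply/h/leqW.
  suff : F m (x - 1) <= y - 1 by lia.
  apply/IH => j hj; have := h j.+1 hj.
  by rewrite (_ : x - 1 - j%:Z = x - j.+1%:Z); lia.
have fj (x : int) (j : nat) : (j <= n)%N -> f (x - j%:Z) + j%:Z <= F n x.
  by move: j; apply/FE.
have F1 (x : int) : F n (x + 1) = F n x + 1.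
  apply/eqP; rewrite eq_le; apply/andP; split.
    apply/FE => -[|j] hj.
      have e1 : f (x + 1 - 0%N%:Z) = f (x - n.-1%:Z) + n%:Z by rewrite -fn; congr (FZ_fun f _); lia.
      by have := fj x n.-1; rewrite e1; lia.
    by have := fj x j; rewrite (_ : x + 1 - j.+1%:Z = x - j%:Z); lia.
  suff : F n x <= F n (x + 1) - 1 by lia.
  apply/FE => j hj; have [jn|jn] := ltnP j n.
    by have := fj (x + 1) j.+1 jn; rewrite (_ : x + 1 - j.+1%:Z = x - j%:Z); lia.
  have -> : j = n by lia.
  have e1 : f (x + 1 - 1%:Z) = f (x - n%:Z) + n%:Z by rewrite -fn; congr (FZ_fun f _); lia.
  by have := fj (x + 1) 1%N n0; rewrite e1; lia.
have F0 : F n = trans (F n 0) by apply: per1_trans => x; apply: F1.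
have Nf (x : int) : f x <= F n x by have := fj x 0%N; rewrite subr0 addr0; apply.
have N0 : 0 <= F n 0 by have := Nf 0; rewrite /f /=; lia.
exists (absz (F n 0)); rewrite gez0_abs //; split; first exact: F0.
move=> x; apply: (@le_trans _ _ (f x)); first by rewrite /f /= le_max lexx.
by have -> : x + F n 0 = F n x by rewrite {2}F0.
Qed.

Definition pow_term (q : lp_term) (c : int) : lp_term :=
  match c with
  | Posz m => iter m (TMul q) TOne
  | Negz m => iter m.+1 (TMul (TL q)) TOne
  end.

Lemma pow_term_trans (v : nat -> FZ) q (N : nat) c : lp_eval v q = trans N%:Z ->
  lp_eval v (pow_term q c) = trans (N%:Z * c).
Proof.
move=> hq; have it q' (d : int) m : lp_eval v q' = trans d ->
    lp_eval v (iter m (TMul q') TOne) = trans (d * m%:Z).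
  move=> hq'; elim: m => [|m IH]; first by apply: FZ_eq => x /=; lia.
  rewrite iterS [lp_eval _ _]/(lp_mul (lp_eval v q') (lp_eval v (iter m (TMul q') TOne))).
  by rewrite hq' IH; apply: etrans (trans_mul _ _) _; congr trans; lia.
case: c => m; first exact: it.
rewrite /pow_term (it _ (- N%:Z)); first by congr trans; lia.
by rewrite /= hq; apply: trans_l.
Qed.

Lemma FZ_neq_lt (f g : FZ_type) : f <> g ->
  (exists x : int, f x < g x) \/ (exists x : int, g x < f x).
Proof.
move=> fg; have [x hx] : exists x : int, f x != g x.
  by apply: contrapT => /forallNP h; apply: fg; apply: FZ_eq => x; have /negP/negPn/eqP := h x.
by have := hx; rewrite neq_lt => /orP[?|?]; [left|right]; exists x.
Qed.

(** * Transfer of equations *)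

Section Transfer.
Variables (A : lpregroup) (E : lp_term * lp_term -> Prop) (n : nat).
Hypotheses (n0 : (0 < n)%N) (AE : forall e, E e -> lp_sat A e)
  (An : forall e, lp_sat (FnZ n) e -> lp_sat A e).

Lemma FnZ_not_sat_lt k : ~ (forall e, E e -> lp_sat (FnZ k) e) ->
  exists a b (u : nat -> FZ) (x : int), [/\ lp_sat A (a, b), forall i, per k (u i) &
    (lp_eval u a : FZ_type) x < (lp_eval u b : FZ_type) x].
Proof.
move=> /existsNP[[a b] /not_implyP[/AE hA /FnZ_satP /existsNP[u /not_implyP[hu /=]]]].
move=> /FZ_neq_lt [[x hx]|[x hx]]; first by exists a, b, u, x.
by exists b, a, u, x; split=> // w; apply/esym/(hA w).
Qed.

(** Let a = b hold in A and a < b at some translations c. For z in F_n(Z), with N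
    the size of the translation above z, the element b^r a at the translations
    N c is at most the translation by -N, so b^r a z <= 1 holds in F_n(Z); as
    1 <= b^r a in A, every z in A is at most 1. *)
Lemma trivial_of_F1_not_sat : ~ (forall e, E e -> lp_sat (FnZ 1) e) -> forall a b : A, a = b.
Proof.
move=> /FnZ_not_sat_lt [a [b [u [x0 [ab hu lt_ab]]]]].
pose c i : int := (u i : FZ_type) 0.
have uE : u = fun i => trans (1%:Z * c i).
  by apply/funext => i; rewrite mul1r; apply: per1_trans.
move: lt_ab; rewrite uE !eval_trans /= !mul1r ltrD2l => lt_ab.
pose y i := pow_term (hull_term n) (c i).
pose w := TMul (TMul (TR (tsubst y b)) (tsubst y a)) (TVar 0).
have w1 : lp_sat (FnZ n) (TMeet w TOne, w).
  apply/FnZ_satP => v hv.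
  have [N [hN vN]] := hull_term_trans n0 (hv 0%N).
  have yE t : lp_eval v (tsubst y t) = trans (N%:Z * @lp_eval int_alg c t).
    rewrite lp_eval_subst -eval_trans; congr lp_eval; apply/funext => i.
    exact: pow_term_trans.
  suff : lp_le (lp_eval v w) lp_one by [].
  have -> : lp_eval v w = @lp_mul FZ (@lp_mul FZ
      (@lp_r FZ (trans (N%:Z * @lp_eval int_alg c b)))
      (trans (N%:Z * @lp_eval int_alg c a))) (v 0%N) by rewrite -!yE.
  rewrite trans_r trans_mul.
  apply/FZ_le => x /=.
  have := vN x; move: (lp_eval (A:=int_alg) c a) (lp_eval (A:=int_alg) c b) lt_ab => α β.
  by move=> /= ?; nia.
apply: lp_trivial => z.
have E2 : lp_le (lp_eval (fun _ => z) w) lp_one := An w1 (fun _ => z).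
apply: lp_le_trans E2; rewrite /= !lp_eval_subst.
rewrite (ab _ : lp_eval _ a = lp_eval _ b).
by have := lp_mul2r (lpP A) z (lp_mulVr (lpP A) (lp_eval (fun i => lp_eval (fun _ => z) (y i)) b)); rewrite (lp_mul1 (lpP A)).
Qed.

Variables s t : lp_term.
Hypothesis st : forall k, (0 < k)%N -> (k %| n)%N ->
  (forall e, E e -> lp_sat (FnZ k) e) -> lp_sat (FnZ k) (s, t).
Hypothesis E1 : forall e, E e -> lp_sat (FnZ 1) e.

Let w := TMul (TR t) s.
Let p := maxn (var_bound s) (var_bound t).

Lemma one_le_residual (B : lpregroup) (v : nat -> B) :
  lp_le lp_one (lp_eval v w) <-> lp_le (lp_eval v t) (lp_eval v s).
Proof. exact: lp_one_le_residual. Qed.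

(** The equation of V that fails in F_k(Z) does so at elements of the algebra of
    uniform values, so that its two sides become terms whose residual h is at
    least 1 in A and moves some point down at all valuations of this shape. *)
Lemma bad_shape (v : nat -> FZ_type) (C : nat) : (forall i, per n (v i)) ->
  @lp_eval FZ v s <> @lp_eval FZ v t ->
  exists2 g, uniform n p v (above1 A) g & forall x : int, g x <= x - C%:Z.
Proof.
move=> hv vst.
have [k [k0 kn perk [f Df f0]]] := subalgebra_period n0 (uniform_closed n p v)
  (fun f => uniform_per hv).
have vk i : (i < p)%N -> per k (v i).
  by move=> ip; apply: perk => //; [apply: uniform_llmul|apply: uniform_mulr].
(* Only the first p variables occur in s and t; the others are sent to 1. *)
pose v2 i : FZ := if (i < p)%N then v i else @lp_one FZ.
have v2E u : (var_bound u <= p)%N -> @lp_eval FZ v u = lp_eval v2 u.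
  by move=> up; apply: lp_eval_ext up _ => i ip; rewrite /v2 ip.
have nk : ~ (forall e, E e -> lp_sat (FnZ k) e).
  move=> Ek; apply: vst; rewrite !v2E ?leq_maxl ?leq_maxr //.
  apply: ((FnZ_satP k (s, t)).1 (st k0 kn Ek)) => i.
  by rewrite /v2; case: ifP => [/vk|_] //; apply: lp_closed1 (per_closed k).
have k1 : (1 < k)%N by rewrite ltn_neqAle k0 andbT; apply/eqP => E2; apply: nk; rewrite -E2.
have fk : per k f.
  by apply: perk; [exact: uniform_per hv Df| |];
    apply: (lp_closedM (uniform_closed n p v)) => //;
    [apply: (lp_closedl (uniform_closed n p v))|apply: (lp_closedr (uniform_closed n p v))].
have gen := steps_generate (uniform_closed n p v) k1 Df fk f0.
have [a [b [u [x0 [ab hu lt_ab]]]]] := FnZ_not_sat_lt nk.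
have /choice [y hy] : forall i, exists q, forall v' : nat -> FZ,
    (forall i, per n (v' i)) -> same_shape n p v v' -> lp_eval v' q = u i.
  by move=> i; have [q _ hq] := gen _ (hu i); exists q.
pose h := TMul (TR (tsubst y b)) (tsubst y a).
pose hf : FZ_type := @lp_mul FZ (@lp_r FZ (lp_eval u b)) (lp_eval u a).
have yE v' c : (forall i, per n (v' i)) -> same_shape n p v v' ->
    @lp_eval FZ v' (tsubst y c) = lp_eval u c.
  move=> h1 h2; rewrite lp_eval_subst; apply: (@lp_eval_ext _ _ _ _ (var_bound c)) => // i _.
  exact: hy.
apply: (@deflate A n p v n0 hf x0 C).
- exists h => [z|v' h1 h2] /=.
    rewrite !lp_eval_subst; apply/lp_one_le_residual.
    by rewrite (ab _ : lp_eval _ a = lp_eval _ b); apply: lp_lexx.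
  by rewrite !yE.
- apply: (per_dvd kn); apply: (lp_closedM (per_closed k)).
    by apply: (lp_closedr (per_closed k)); apply: lp_eval_closed (per_closed k) hu.
  exact: lp_eval_closed (per_closed k) hu.
- rewrite /hf /= ltNge le_fun_r -ltNge; exact: lt_ab.
Qed.

(** The residual is at least 1 on translations, and every valuation is within
    distance n of one by translations. *)
Lemma residual_bounded_below : exists C : nat, forall v : nat -> FZ, (forall i, per n (v i)) ->
  forall x : int, x - C%:Z <= (lp_eval v w : FZ_type) x.
Proof.
have [C hC] := eval_close w n0; exists C => v hv x.
pose v' i : FZ := trans ((v i : FZ_type) 0).
have v'n m i : per m (v' i) by apply: per_trans.
have close_v i : close n (v i) (v' i).
  by move=> y; have := per_near_trans y n0 (hv i); rewrite /v' /=; lia.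
have [_] := hC v v' hv (v'n n) close_v x; suff : x <= (lp_eval v' w : FZ_type) x by lia.
have E2 : lp_eval v' s = lp_eval v' t.
  by apply: ((FnZ_satP 1 (s, t)).1 (st _ (dvd1n n) E1)).
have : lp_le lp_one (lp_eval v' w).
  by apply/one_le_residual; rewrite E2; apply: lp_lexx.
by move/FZ_le; apply.
Qed.

(** A meet over the finitely many shapes: a shape at which s = t never fails
    contributes 1, any other one a term deflated below the lower bound of w. *)
Lemma residual_above_term : exists2 q, above1 A q & forall v : nat -> FZ,
  (forall i, per n (v i)) -> lp_le (lp_eval v q) (lp_eval v w).
Proof.
have [C hC] := residual_bounded_below.
have [T [sh hsh]] := finite_shapes p n0.
suff [q q1 hq] : exists2 q, above1 A q & forall v : nat -> FZ, (forall i, per n (v i)) ->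
    sh v \in enum T -> lp_le (lp_eval v q) (lp_eval v w).
  by exists q => // v hv; apply: hq; rewrite ?mem_enum.
elim: (enum T) => [|c l [q q1 hq]].
  by exists TOne => // u; apply: lp_lexx.
suff [q' q1' hq'] : exists2 q, above1 A q & forall v : nat -> FZ, (forall i, per n (v i)) ->
    sh v = c -> lp_le (lp_eval v q) (lp_eval v w).
  exists (TMeet q' q) => [u|v hv]; first exact: lp_lexI.
  rewrite in_cons => /orP[/eqP vc|vl].
    exact: lp_le_trans (lp_leIl _ _) (hq' _ hv vc).
  exact: lp_le_trans (lp_leIr _ _) (hq _ hv vl).
have [[v [hv vc vst]]|good] := pselect (exists v : nat -> FZ,
    [/\ forall i, per n (v i), sh v = c & lp_eval v s <> lp_eval v t]).
- have [g [q' q1' hq'] gC] := bad_shape C hv vst.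
  exists q' => // v' hv' v'c; rewrite hq' //; last by apply: hsh; rewrite ?v'c.
  by apply/FZ_le => x; apply: le_trans (gC x) (hC _ hv' x).
- exists TOne => [u|v hv vc]; first exact: lp_lexx.
  apply/one_le_residual.
  have -> : lp_eval v s = lp_eval v t by apply: contrapT => vst; apply: good; exists v.
  exact: lp_lexx.
Qed.

Lemma le_of_periods (u : nat -> A) : lp_le (lp_eval u t) (lp_eval u s).
Proof.
have [q q1 hq] := residual_above_term.
have /An/(_ u) /= E2 : lp_sat (FnZ n) (TMeet q w, q) by apply/FnZ_satP => v /hq.
by apply/one_le_residual; apply: lp_le_trans (q1 u) E2.
Qed.

End Transfer.

Lemma sat_of_periods (A : lpregroup) (E : lp_term * lp_term -> Prop) (n : nat) s t : (0 < n)%N ->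
  (forall e, E e -> lp_sat A e) -> (forall e, lp_sat (FnZ n) e -> lp_sat A e) ->
  (forall k, (0 < k)%N -> (k %| n)%N ->
    (forall e, E e -> lp_sat (FnZ k) e) -> lp_sat (FnZ k) (s, t)) ->
  lp_sat A (s, t).
Proof.
move=> n0 AE An st u /=.
have [E1|nE1] := pselect (forall e, E e -> lp_sat (FnZ 1) e); last exact: (trivial_of_F1_not_sat n0 AE An nE1).
apply: lp_le_anti; last exact: (le_of_periods n0 AE An st E1).
by apply: (le_of_periods n0 AE An _ E1) => k k0 kn Ek v; apply/esym/(st k k0 kn Ek).
Qed.

Theorem corollary6p15 (n : nat) (hn : (0 < n)%N)
    (V : lpregroup -> Prop) (hV : is_variety V)
    (hsub : forall A : lpregroup, V A -> variety_gen (fun _ : 'I_1 => FnZ n) A) :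
  exists (m : nat) (k : 'I_m -> nat),
    (forall i : 'I_m, (0 < k i)%N /\ (k i %| n)%N) /\
    (forall A : lpregroup, V A <-> variety_gen (fun i : 'I_m => FnZ (k i)) A).
Proof.
pose ks := [seq k <- divisors n | `[< V (FnZ k) >]].
have ksP k : k \in ks <-> V (FnZ k) /\ (k %| n)%N.
  rewrite mem_filter -dvdn_divisors //.
  by split=> [/andP[/asboolP]|[h ->]] //; rewrite andbT; apply/asboolP.
exists (size ks), (tnth (in_tuple ks)); split=> [i|A].
  by have /ksP[_ kn] := mem_tnth i (in_tuple ks); rewrite (dvdn_gt0 hn kn).
split=> [VA W [E' hW] WK|hA]; last first.
  by apply: hA => // i; have /ksP[] := mem_tnth i (in_tuple ks).
case: hV => E hE; apply/hW => -[s t] st.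
apply: (sat_of_periods hn (E := E)) => [e Ee|e he|k k0 kn Ek].
- exact: ((hE A).1 VA).
- exact: variety_gen_sat (hsub A VA) (fun=> he).
- have /tnthP[i ->] : k \in in_tuple ks by apply/ksP; split=> //; apply/hE.
  exact: ((hW _).1 (WK i)).
Qed.
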